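(* Let $G=(V,W)$ be a connected $(r,s)$-semiregular bipartite graph with $\nu$ vertices and $\epsilon$ edges. Set $|V|=m$ and $|W|=n$ with $m\le n$. Let ${\bf P}$ be the transition probability matrix of the correlated random walk on $G$ with respect to the Grover matrix, and let the spectrum of the adjacency matrix ${\bf A}(G)$ be $$\mathrm{Spec}({\bf A}(G))=\{\pm\lambda_1,\ldots,\pm\lambda_m,0,\ldots,0\}.$$ Then the transition matrix ${\bf P}$ has $2\epsilon$ eigenvalues of the following form: 1. $4m$ eigenvalues: $$\lambda=\pm\sqrt{\frac{2r^2s^2-4rs^2-4r^2s+16\lambda_j^2\pm\sqrt{(2r^2s^2-4rs^2-4r^2s+16\lambda_j^2)^2-4r^3s^3(4-r)(4-s)}}{2r^2s^2}}$$ (where $j=1,\ldots,m$); 2. $2n-2m$ eigenvalues: $$\lambda=\pm i\sqrt{\frac4r-1};$$ 3. $2(\epsilon-\nu)$ eigenvalues: $$\lambda=\pm\sqrt{\left(\frac4r-1\right)\left(\frac4s-1\right)}.$$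
   Context: Graphs are finite and simple. A bipartite graph $G=(V,W)$ with vertex classes $V,W$ is $(r,s)$-semiregular if $\deg v=r$ for every $v\in V$ and $\deg w=s$ for every $w\in W$. For a graph $G$ with edge set $E(G)$, $D(G)=\{(u,v),(v,u)\mid uv\in E(G)\}$ is its set of arcs. For $e=(u,v)\in D(G)$, write $o(e)=u$, $t(e)=v$, $e^{-1}=(v,u)$, and let $d_v=\deg v$ be the number of vertices adjacent to $v$. If $G$ has $\epsilon$ edges, then $|D(G)|=2\epsilon$. The Grover matrix of $G$ is the matrix ${\bf U}=(U_{ef})_{e,f\in D(G)}$ with $U_{ef}=2/d_{t(f)}$ if $t(f)=o(e)$ and $f\ne e^{-1}$; $U_{ef}=2/d_{t(f)}-1$ if $f=e^{-1}$; and $U_{ef}=0$ otherwise. The correlated random walk on $G$ with respect to the Grover matrix is the random walk on $D(G)$ whose transition probability matrix is ${\bf P}=(P_{ef})_{e,f\in D(G)}$ with $P_{ef}=|U_{ef}|^2$. Square roots are complex square roots, and all choices of signs are taken.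
   Formalization: If G is a tree, the count 2(ε−ν) is −2 and the claim fails literally (for K₂, family 1 gives ±3, ±1 but P has only ±1); the formal version reads this as a signed multiplicity, so the pair in 3 is removed once from the other families; all other graphs are as stated. *)

(* Defs.v *)
From mathcomp Require Import all_boot all_order all_algebra.

Set Implicit Arguments.
Unset Strict Implicit.
Unset Printing Implicit Defensive.

Import Order.TTheory GRing.Theory Num.Theory.
Local Open Scope ring_scope.

Record sgraph := SGraph {
  vertex :> finType;
  adj : rel vertex;
  adj_sym : symmetric adj;
  adj_irr : irreflexive adj
}.

Section Graph.
Variable G : sgraph.

Definition edges : {set {set G}} :=
  [set [set a.1; a.2] | a in [set a : G * G | adj a.1 a.2]].

Definition deg (v : G) : nat := #|[set u : G | adj v u]|.

Definition connected_graph : Prop := forall u v : G, connect (@adj G) u v.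

Definition bipartite (V W : {set G}) : Prop :=
  [/\ [disjoint V & W], V :|: W = [set: G] &
      forall u v : G, adj u v ->
        (u \in V /\ v \in W) \/ (u \in W /\ v \in V)].

Definition semiregular_bipartite (V W : {set G}) (r s : nat) : Prop :=
  [/\ bipartite V W, (forall v, v \in V -> deg v = r) &
      (forall w, w \in W -> deg w = s)].

Definition arc : finType := {a : G * G | adj a.1 a.2}.

Definition org (e : arc) : G := (val e).1.
Definition tgt (e : arc) : G := (val e).2.

Fact arc_inv_subproof (e : arc) : adj (tgt e, org e).1 (tgt e, org e).2.
Proof. by rewrite /= adj_sym; apply: (valP e). Qed.

Definition arc_inv (e : arc) : arc :=
  exist (fun a : G * G => adj a.1 a.2) (tgt e, org e) (arc_inv_subproof e).

End Graph.

(* Matrices indexed by a finite type are indexed by the ranks of its elements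
   in the canonical enumeration. *)
Section Matrices.
Variables (C : numClosedFieldType) (G : sgraph).

Definition adjacency : 'M[C]_#|G| :=
  \matrix_(i, j) (adj (enum_val i) (enum_val j))%:R.

Definition grover_coef (e f : arc G) : C :=
  if f == arc_inv e then 2%:R / (deg (tgt f))%:R - 1
  else if tgt f == org e then 2%:R / (deg (tgt f))%:R
  else 0.

Definition grover : 'M[C]_#|arc G| :=
  \matrix_(i, j) grover_coef (enum_val i) (enum_val j).

Definition transition : 'M[C]_#|arc G| :=
  \matrix_(i, j) `|grover i j| ^+ 2.

End Matrices.

(* The eigenvalues of a square matrix, listed with algebraic multiplicity, in
   an unspecified order: lists of eigenvalues are to be compared by perm_eq. *)
Definition spectrum (C : numClosedFieldType) (k : nat) (M : 'M[C]_k) : seq C :=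
  sval (closed_field_poly_normal (char_poly M)).

Lemma spectrumP (C : numClosedFieldType) (k : nat) (M : 'M[C]_k) :
  char_poly M = \prod_(z <- spectrum M) ('X - z%:P).
Proof.
rewrite /spectrum; case: closed_field_poly_normal => s /= {1}->.
by rewrite (monicP (char_poly_monic M)) scale1r.
Qed.

Definition pm (C : numClosedFieldType) (z : C) : seq C := [:: z; - z].

(* Main.v *)
From mathcomp Require Import all_boot all_order all_algebra.
From mathcomp Require Import ring.
Require Import Defs.

(** Write [a = 1 - 4/r] and [b = 1 - 4/s], let [O] and [T] be the arc-by-vertex
    incidence matrices of the origins and of the termini, [D] the diagonal
    matrix of the [4 / deg v ^ 2], and [K] the arc reversal weighted at [e] by
    [1 - 4 / deg (o e)].  Squaring the entries of the Grover matrix gives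

      P = O D T^t + K                                        (transitionE),

    a perturbation of [K] that factors through the vertices.

    The two ends of an arc lie on different sides, so reversing an arc twice
    collects the weights [a] and [b]: [K ^ 2 = a b].  With [y = x ^ 2 - a b] it
    follows that [(x - P) (x + K) = y - O B], where [B = D T^t (x + K)].
    Moreover [K] anticommutes with the sign that tells the two orientations
    apart, so that [det (x + K) = y ^ eps] (char_poly_anticomm).  Exchanging the
    two factors of [O B] (det_scalar_sub_mulmx) moves the computation from the
    [2 eps] arcs to the [nu] vertices, where [B O = x D A + (diagonal)], with
    [A] the adjacency matrix.  The result (det_transition) is

      det (x - P) y ^ nu
        = y ^ eps det (diag (x ^ 2 - b on V, x ^ 2 - a on W) - x D A).

    Since [A] only joins [V] to [W], rescaling rows and columns turns the last
    matrix into [c - A], where [c ^ 2] is the product of the two diagonal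
    entries divided by that of the two off-diagonal weights (det_bipartite).
    The spectrum of [A] then gives the factor [(x ^ 2 - a) ^ (n - m)] and, for
    each [j], the factor

      (x ^ 2 - a) (x ^ 2 - b) - 16 x ^ 2 lam_j ^ 2 / (r ^ 2 s ^ 2),

    a quadratic polynomial in [x ^ 2] whose roots are the squares of the four
    eigenvalues attached to [j].

    All this is a computation with numbers, valid outside finitely many [x],
    which is enough to identify the two polynomials.  Division by [r] and [s]
    requires positive degrees; connectedness is what reduces the remaining case
    to graphs with at most one vertex. *)

Import Order.TTheory GRing.Theory Num.Theory.
Local Open Scope ring_scope.
Set Implicit Arguments.
Unset Strict Implicit.
Unset Printing Implicit Defensive.

(** * Determinants and polynomials *)

(** Both sides are [y ^ q] times the determinant of the block matrix
    [[y, A], [B, 1]], computed by eliminating one or the other off-diagonal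
    block.  The powers of [y] avoid any division. *)
Lemma det_scalar_sub_mulmx (R : comNzRingType) p q (A : 'M[R]_(p, q))
    (B : 'M[R]_(q, p)) (y : R) :
  y ^+ q * \det (y%:M - A *m B) = y ^+ p * \det (y%:M - B *m A).
Proof.
pose X := block_mx y%:M A B 1%:M.
have detX : \det (y%:M - A *m B) = \det X.
  have <- : \det (block_mx 1%:M (- A) 0 1%:M *m X) = \det X.
    by rewrite det_mulmx det_ublock !det1 !mul1r.
  rewrite mulmx_block !mul1mx !mul0mx !mulmx1 !mulNmx !add0r subrr.
  by rewrite det_lblock det1 mulr1.
rewrite detX.
have <- : \det (block_mx 1%:M 0 (- B) y%:M *m X) = y ^+ q * \det X.
  by rewrite det_mulmx det_lblock det1 det_scalar mul1r.
rewrite mulmx_block !mul1mx !mul0mx !mulmx1 !mulNmx !addr0.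
rewrite mul_mx_scalar mul_scalar_mx addNr addrC det_ublock det_scalar.
by rewrite addrC.
Qed.

Lemma horner_char_poly (R : comNzRingType) k (A : 'M[R]_k) (x : R) :
  (char_poly A).[x] = \det (x%:M - A).
Proof.
rewrite -[_.[x]]/(horner_eval x _) -det_map_mx; congr (\det _).
apply/matrixP=> i j; rewrite !mxE -[LHS]/(_.[x]).
by rewrite !(hornerD, hornerN, hornerMn, hornerC, hornerX).
Qed.

(** The involution [S] conjugates [K] to [- K], so [x - K] and [x + K] have the
    same determinant, while their product is the scalar [x ^ 2 - c].  This gives
    the square of the characteristic polynomial; being monic fixes the sign of
    the square root. *)
Lemma char_poly_anticomm (F : numDomainType) k N (K S : 'M[F]_N) (c : F) :
    N = (2 * k)%N -> S *m S = 1%:M -> S *m K *m S = - K -> K *m K = c%:M ->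
  char_poly K = ('X^2 - c%:P) ^+ k.
Proof.
move=> NE SS SKS KK; set D := _ ^+ k.
pose K' : 'M[{poly F}]_N := map_mx polyC K.
pose S' : 'M[{poly F}]_N := map_mx polyC S.
have conjK : S' *m ('X%:M - K') *m S' = 'X%:M + K'.
  rewrite mulmxBr mulmxBl -!map_mxM SKS map_mxN opprK.
  by rewrite mul_mx_scalar -scalemxAl -map_mxM SS map_mx1 scalemx1.
have detS : \det S' * \det S' = 1.
  by rewrite -det_mulmx -map_mxM SS map_mx1 det1.
have: char_poly K ^+ 2 = D ^+ 2.
  rewrite {1}expr2 {1}/char_poly /char_poly_mx -/K'.
  rewrite -[RHS]exprM mulnC -NE -det_scalar.
  have -> : ('X^2 - c%:P)%:M = ('X%:M - K') *m (S' *m ('X%:M - K') *m S').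
    rewrite conjK mulmxDr !mulmxBl -map_mxM KK map_scalar_mx.
    rewrite !mul_mx_scalar !mul_scalar_mx scale_scalar_mx -expr2 raddfB /=.
    by rewrite addrA subrK.
  by rewrite !det_mulmx [_ * \det S']mulrAC detS mul1r.
move/eqP; rewrite eqf_sqr => /orP[/eqP // | /eqP charN].
have /monicP := char_poly_monic K.
have /monicP : D \is monic by rewrite monic_exp // monicXnsubC.
rewrite charN lead_coefN => -> /eqP.
by rewrite -subr_eq0 -opprD oppr_eq0 -mulr2n pnatr_eq0.
Qed.

Lemma eq_poly_outside_roots (F : closedFieldType) (g p q : {poly F}) :
  g != 0 -> (forall x, g.[x] != 0 -> p.[x] = q.[x]) -> p = q.
Proof.
move=> g0 epq; apply/eqP; rewrite -subr_eq0; apply: contraT => pq0.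
have /closed_nonrootP[x] : g * (p - q) != 0 by rewrite mulf_neq0.
rewrite rootM negb_or => /andP[gx]; rewrite /root !hornerE.
by rewrite epq ?subrr ?eqxx.
Qed.

Definition two_scalar_mx (R : pzSemiRingType) N (d : pred 'I_N) (a b : R) :
  'M[R]_N := diag_mx (\row_i (if d i then a else b)).

Lemma det_two_scalar_mx (R : comNzRingType) N (d : pred 'I_N) (a b : R) :
  \det (two_scalar_mx d a b) = a ^+ #|d| * b ^+ #|predC d|.
Proof.
rewrite det_diag (bigID d) /= -!prodr_const; congr (_ * _).
  by apply: eq_bigr => i di; rewrite mxE [d i]di.
by apply: eq_bigr => i /negbTE di; rewrite mxE di.
Qed.

(** When [A] only relates indices on different sides of [d], the matrix on the
    left is obtained from [c - A] by rescaling rows and columns: the scale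
    factors must give the products [al] and [be] on the diagonal and [p] and [q]
    off it, which the condition on [c ^ 2] makes possible. *)
Lemma det_bipartite (F : fieldType) N (d : pred 'I_N) (A : 'M[F]_N)
    (al be p q c : F) :
    (forall i j, d i = d j -> A i j = 0) ->
    p != 0 -> c != 0 -> c ^+ 2 * (p * q) = al * be ->
  \det (two_scalar_mx d al be - two_scalar_mx d p q *m A)
    = al ^+ #|d| * be ^+ #|predC d| / c ^+ N * (char_poly A).[c].
Proof.
move=> A0 p0 c0 e.
have -> : two_scalar_mx d al be - two_scalar_mx d p q *m A
   = two_scalar_mx d p (be / c) *m (c%:M - A)
     *m two_scalar_mx d (al / (c * p)) 1.
  rewrite !mul_diag_mx mul_mx_diag; apply/matrixP=> i j; rewrite !mxE.
  case: eqVneq => [->|nij]; rewrite ?mulr1n ?mulr0n.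
    rewrite A0 // !mulr0 !subr0.
    by case: (d j); field; rewrite ?c0 ?p0.
  case: (boolP (d i == d j)) => [/eqP dij|]; first by rewrite A0 //; ring.
  case: (d i) (d j) => [] [] // _; first by ring.
  (* On this block the scaling gives (be / c) * (al / (c * p)), which is q. *)
  have -> : q = al * be / (c ^+ 2 * p) by rewrite -e; field; rewrite ?c0 ?p0.
  by field; rewrite ?c0 ?p0.
rewrite !det_mulmx !det_two_scalar_mx horner_char_poly.
have -> : c ^+ N = c ^+ #|d| * c ^+ #|predC d|.
  by rewrite -exprD cardC card_ord.
rewrite expr1n mulr1 !expr_div_n exprMn.
by field; rewrite !expf_neq0.
Qed.
(** * Incidence matrices of arcs and vertices *)

Section Graph.
Variables (C : numClosedFieldType) (G : sgraph).

Lemma sum_arc (M : nmodType) (F : G -> G -> M) :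
  \sum_(e : arc G) F (org e) (tgt e) = \sum_u \sum_(v | adj u v) F u v.
Proof.
rewrite (pair_big_dep xpredT (@adj G)) /=.
exact: (esym (big_sub [pred a | adj a.1 a.2] (fun a : G * G => F a.1 a.2))).
Qed.

(** The map forgetting the orientation of an arc has fibres of size two, as
    there are no loops. *)
Lemma card_arc : #|arc G| = (2 * #|edges G|)%N.
Proof.
have -> : #|arc G| = #|[set a : G * G | adj a.1 a.2]|.
  by rewrite card_sig cardsE.
rewrite -sum1_card.
rewrite (partition_big_imset (fun a : G * G => [set a.1; a.2])) /=.
rewrite -/(edges G) mulnC -sum_nat_const; apply: eq_bigr => E /imsetP[[u v]].
rewrite inE /= => uv ->; rewrite sum1dep_card.
have nuv : u != v by apply: contraTneq uv => ->; rewrite adj_irr.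
rewrite (_ : [set _ | _] = [set (u, v); (v, u)]).
  by rewrite cards2 xpair_eqE (negbTE nuv).
apply/setP=> -[x y]; rewrite !inE /= !xpair_eqE; apply/andP/orP.
  case=> xy /eqP e.
  have: x \in [set u; v] by rewrite -e set21.
  have: y \in [set u; v] by rewrite -e set22.
  move: xy; rewrite !inE => xy /orP[]/eqP yE /orP[]/eqP xE; subst x y;
    rewrite ?eqxx ?adj_irr // in xy *; by [left | right].
case=> /andP[/eqP-> /eqP->]; first by rewrite uv eqxx.
by rewrite adj_sym uv setUC eqxx.
Qed.

Lemma arc_invK : involutive (@arc_inv G).
Proof. by move=> e; apply: val_inj; case: e => -[]. Qed.

Lemma org_inv (e : arc G) : org (arc_inv e) = tgt e. Proof. by []. Qed.
Lemma tgt_inv (e : arc G) : tgt (arc_inv e) = org e. Proof. by []. Qed.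

Definition org_mx : 'M[C]_(#|arc G|, #|G|) :=
  \matrix_(i, j) (org (enum_val i) == enum_val j)%:R.
Definition tgt_mx : 'M[C]_(#|arc G|, #|G|) :=
  \matrix_(i, j) (tgt (enum_val i) == enum_val j)%:R.
Definition reversal_mx (a : G -> C) : 'M[C]_#|arc G| :=
  \matrix_(i, j) (if enum_val j == arc_inv (enum_val i)
                  then a (org (enum_val i)) else 0).

Lemma sum_arc_enum (M : nmodType) (F : arc G -> M) :
  \sum_(i < #|arc G|) F (enum_val i) = \sum_e F e.
Proof. by rewrite -big_enum_val. Qed.

Lemma sum_delta (T : finType) (u : T) (F : T -> C) :
  \sum_v (u == v)%:R * F v = F u.
Proof.
rewrite (bigD1 u) //= eqxx mul1r big1 ?addr0 // => v.
by rewrite eq_sym => /negbTE->; rewrite mul0r.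
Qed.

(** Reversing twice fixes every arc, and meets the weight of its origin, then
    that of its terminus. *)
Lemma reversal_mxM (a b : G -> C) :
  reversal_mx a *m reversal_mx b
    = diag_mx (\row_i (a (org (enum_val i)) * b (tgt (enum_val i)))).
Proof.
apply/matrixP=> i j; rewrite !mxE.
rewrite (bigD1 (enum_rank (arc_inv (enum_val i)))) //= !mxE enum_rankK eqxx.
rewrite arc_invK org_inv (inj_eq enum_val_inj) big1 ?addr0 => [|k nk].
  by rewrite eq_sym; case: eqP; rewrite ?mulr0.
rewrite !mxE; case: eqP => [e|_]; last by rewrite mul0r.
by rewrite -e enum_valK eqxx in nk.
Qed.

Lemma reversal_mx_org (a : G -> C) :
  reversal_mx a *m org_mx
    = diag_mx (\row_i a (org (enum_val i))) *m tgt_mx.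
Proof.
rewrite mul_diag_mx; apply/matrixP=> i j; rewrite !mxE.
rewrite (bigD1 (enum_rank (arc_inv (enum_val i)))) //= !mxE enum_rankK eqxx.
rewrite org_inv big1 ?addr0 // => k nk.
rewrite !mxE; case: eqP => [e|_]; last by rewrite mul0r.
by rewrite -e enum_valK eqxx in nk.
Qed.

Lemma tgt_org_mx : tgt_mx^T *m org_mx = adjacency C G.
Proof.
apply/matrixP=> i j; rewrite !mxE.
under eq_bigr do rewrite !mxE.
rewrite (sum_arc_enum (fun e => (tgt e == enum_val i)%:R
           * (org e == enum_val j)%:R)).
rewrite (sum_arc (fun u v => (v == enum_val i)%:R * (u == enum_val j)%:R)).
rewrite (bigD1 (enum_val j)) //= [X in _ + X]big1 ?addr0; last first.
  by move=> u /negbTE->; rewrite big1 // => v _; rewrite mulr0.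
rewrite eqxx big_mkcond /= (bigD1 (enum_val i)) //= big1 ?addr0; last first.
  by move=> v /negbTE->; rewrite mul0r if_same.
by rewrite eqxx mulr1 adj_sym; case: adj.
Qed.

Lemma tgt_diag_tgt_mx (a : G -> C) :
  tgt_mx^T *m (diag_mx (\row_i a (org (enum_val i))) *m tgt_mx)
    = diag_mx (\row_i \sum_(u | adj u (enum_val i)) a u).
Proof.
rewrite mul_diag_mx; apply/matrixP=> i j; rewrite !mxE.
under eq_bigr do rewrite !mxE.
rewrite (sum_arc_enum (fun e => (tgt e == enum_val i)%:R
           * (a (org e) * (tgt e == enum_val j)%:R))).
rewrite (sum_arc (fun u v => (v == enum_val i)%:R
           * (a u * (v == enum_val j)%:R))).
rewrite [in RHS]big_mkcond -sumrMnl; apply: eq_bigr => u _.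
rewrite big_mkcond (bigD1 (enum_val i)) //= big1 ?addr0; last first.
  by move=> v /negbTE->; rewrite mul0r if_same.
rewrite eqxx mul1r (inj_eq enum_val_inj) mulr_natr.
by case: adj; rewrite ?mul0rn.
Qed.

(** The value [(2/d) ^ 2 = 4/d ^ 2] of the squared Grover matrix is
    attained at the pairs of consecutive arcs; at a backtracking pair the
    excess [(2/d - 1) ^ 2 - 4/d ^ 2] is [1 - 4/d]. *)
Lemma transitionE :
  transition C G
    = org_mx *m diag_mx (\row_i (4 / (deg (enum_val i))%:R ^+ 2)) *m tgt_mx^T
      + reversal_mx (fun v => 1 - 4 / (deg v)%:R).
Proof.
apply/matrixP=> i j; rewrite mul_mx_diag !mxE.
under eq_bigr do rewrite !mxE.
set e := enum_val i; set f := enum_val j.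
rewrite -(big_enum_val (fun v => (org e == v)%:R * (4 / (deg v)%:R ^+ 2)
           * (tgt f == v)%:R)) /=.
under eq_bigr do rewrite -mulrA.
rewrite sum_delta /grover_coef.
have [->|_] := eqVneq f (arc_inv e).
  rewrite tgt_inv eqxx mulr1.
  rewrite real_normK; last first.
    by apply: realB (real1 _); apply: realM; rewrite ?realV realn.
  have [->|d0] := eqVneq ((deg (org e))%:R : C) 0; last by field.
  by rewrite expr0n !invr0 !mulr0 sub0r subr0 sqrrN expr1n add0r.
rewrite addr0; have [->|_] := eqVneq (tgt f) (org e).
  by rewrite mulr1 normrM normfV !normr_nat expr_div_n -(natrX _ 2 2).
by rewrite normr0 expr0n mulr0.
Qed.

End Graph.
(** * Semiregular bipartite graphs *)

Section Semiregular.
Variables (C : numClosedFieldType) (G : sgraph) (V W : {set G}) (r s : nat).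
Hypothesis Gsemi : semiregular_bipartite V W r s.
Hypotheses (r_gt0 : (0 < r)%N) (s_gt0 : (0 < s)%N).

Let R : C := r%:R.
Let S : C := s%:R.
Let a : C := 1 - 4 / R.
Let b : C := 1 - 4 / S.
Let d : pred 'I_#|G| := fun i => enum_val i \in V.
Let wt (v : G) : C := 1 - 4 / (deg v)%:R.

Lemma bipartite_adj (u v : G) : adj u v -> (v \in V) = (u \notin V).
Proof.
case: Gsemi => -[dVW _ bip] _ _ /bip [[uV vW]|[uW vV]].
  by rewrite uV (disjointFl dVW vW).
by rewrite vV (disjointFl dVW uW).
Qed.

Lemma bipartite_setC : W = ~: V.
Proof.
case: Gsemi => -[dVW uVW _] _ _; apply/setP=> v; rewrite inE.
have := in_setT v; rewrite -uVW inE; case: (boolP (v \in V)) => //= vV _.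
exact: disjointFr dVW vV.
Qed.

Lemma deg_semiregular v : deg v = if v \in V then r else s.
Proof.
case: Gsemi => _ degV degW; case: ifP => vV; first exact: degV.
by apply: degW; rewrite bipartite_setC inE vV.
Qed.

Lemma card_side : (#|d| = #|V|)%N * (#|predC d| = #|W|)%N.
Proof.
have card_enum (A : {set G}) : #|[pred i : 'I_#|G| | enum_val i \in A]| = #|A|.
  by rewrite -!sum1_card [RHS](reindex _ (onW_bij _ (@enum_val_bij G))).
rewrite -[#|V|]card_enum bipartite_setC -[#|~: V|]card_enum.
by split=> //; apply: eq_card => i; rewrite !inE.
Qed.

Let wtE v : wt v = if v \in V then a else b.
Proof. by rewrite /wt deg_semiregular; case: ifP. Qed.

Lemma wt_arc (e : arc G) : wt (org e) * wt (tgt e) = a * b.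
Proof.
rewrite !wtE (bipartite_adj (valP e)) -/(org e).
by case: (org e \in V) => //=; rewrite mulrC.
Qed.

(** The sign distinguishes arcs leaving [V] from arcs leaving [W]; reversal
    exchanges the two kinds.  The scalar [z] is there to cover [- K], whose
    characteristic polynomial at [x] is [det (x + K)]. *)
Lemma char_poly_reversal (z : C) : z ^+ 2 = 1 ->
  char_poly (z *: reversal_mx wt) = ('X^2 - (a * b)%:P) ^+ #|edges G|.
Proof.
move=> z2.
pose sgn : 'M[C]_#|arc G| :=
  diag_mx (\row_i (-1) ^+ (org (enum_val i) \in V)).
apply: (char_poly_anticomm (S := sgn)); first exact: card_arc.
- rewrite mul_diag_mx; apply/matrixP=> i j; rewrite !mxE.
  by rewrite mulrnAr -signr_addb addbb.
- rewrite mul_diag_mx mul_mx_diag; apply/matrixP=> i j; rewrite !mxE.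
  case: eqP => [->|_]; last by rewrite !(mulr0, mul0r, oppr0).
  rewrite org_inv (bipartite_adj (valP (enum_val i))) -/(org (enum_val i)).
  by case: (_ \in V) => /=; rewrite ?expr0 ?expr1; ring.
- rewrite -scalemxAl -scalemxAr scalerA -expr2 z2 scale1r reversal_mxM.
  apply/matrixP=> i j; rewrite !mxE; case: eqP => [_|//].
  by rewrite wt_arc.
Qed.

Lemma sum_wt_adj (v : G) :
  \sum_(u | adj u v) wt u = if v \in V then R * b else S * a.
Proof.
under eq_bigl do rewrite adj_sym.
rewrite (eq_bigr (fun=> if v \in V then b else a)) => [|u uv].
  rewrite sumr_const -[X in _ *+ X]cardsE -/(deg v) deg_semiregular.
  by case: ifP => _; rewrite -mulr_natl.
by rewrite wtE (bipartite_adj uv); case: (v \in V).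
Qed.

(** The passage from arcs to vertices: [(x - P) (x + K) = y - O B], where [O B]
    factors through the vertices and [B O] is computed there.  At a vertex of
    [V] the diagonal entry is [x ^ 2 - a b - (4 / r ^ 2) r b = x ^ 2 - b]. *)
Lemma det_transition (x : C) :
    x ^+ 2 != a * b ->
  (char_poly (transition C G)).[x] * (x ^+ 2 - a * b) ^+ #|G|
    = (x ^+ 2 - a * b) ^+ #|edges G|
      * \det (two_scalar_mx d (x ^+ 2 - b) (x ^+ 2 - a)
        - two_scalar_mx d (4 * x / R ^+ 2) (4 * x / S ^+ 2) *m adjacency C G).
Proof.
move=> xab; set y := x ^+ 2 - a * b.
have R0 : R != 0 by rewrite pnatr_eq0 -lt0n.
have S0 : S != 0 by rewrite pnatr_eq0 -lt0n.
have y0 : y != 0 by rewrite subr_eq0.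
pose K := reversal_mx wt.
pose D4 : 'M[C]_#|G| := diag_mx (\row_i (4 / (deg (enum_val i))%:R ^+ 2)).
pose B := D4 *m (tgt_mx C G)^T *m (x%:M + K).
have detK (z : C) : z ^+ 2 = 1 -> \det (x%:M - z *: K) = y ^+ #|edges G|.
  by move=> /char_poly_reversal e; rewrite -horner_char_poly e !hornerE.
have detP : (char_poly (transition C G)).[x] * y ^+ #|edges G|
            = \det (y%:M - org_mx C G *m B).
  rewrite horner_char_poly -(detK (-1)) ?sqrrN ?expr1n // scaleN1r opprK.
  rewrite -det_mulmx; congr (\det _); rewrite transitionE -/K -/D4.
  rewrite opprD addrA addrAC mulmxDl mulNmx /B -!mulmxA; congr (_ - _).
  rewrite mulmxDr !mulmxBl !mul_mx_scalar !mul_scalar_mx scale_scalar_mx.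
  have -> : K *m K = (a * b)%:M.
    rewrite reversal_mxM; apply/matrixP=> i j; rewrite !mxE.
    by case: eqP => [_|//]; rewrite wt_arc.
  by rewrite addrA subrK /y raddfB /= expr2.
have BS : y%:M - B *m org_mx C G = two_scalar_mx d (x ^+ 2 - b) (x ^+ 2 - a)
        - two_scalar_mx d (4 * x / R ^+ 2) (4 * x / S ^+ 2) *m adjacency C G.
  rewrite /B -!mulmxA mulmxDl mul_scalar_mx reversal_mx_org mulmxDr.
  rewrite -scalemxAr tgt_org_mx tgt_diag_tgt_mx mulmxDr opprD addrCA addrC.
  rewrite !mul_diag_mx.
  congr (_ - _); apply/matrixP=> i j; rewrite !mxE; last first.
    by rewrite deg_semiregular /d; case: ifP => _; field.
  rewrite sum_wt_adj deg_semiregular /d; case: eqP => [_|_]; last first.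
    by rewrite !mulr0n mulr0 subr0.
  rewrite !mulr1n /y /a /b -/R -/S.
  by case: ifP => _; field; rewrite ?R0 ?S0.
apply: (mulIf (expf_neq0 #|edges G| y0)).
rewrite mulrAC detP mulrC det_scalar_sub_mulmx BS card_arc mul2n -addnn exprD.
by rewrite mulrAC.
Qed.

Lemma det_transition_spectrum m n (lam : 'I_m -> C) (x : C) :
    #|V| = m -> #|W| = n -> (m <= n)%N ->
    perm_eq (spectrum (adjacency C G))
      (flatten [seq pm (lam j) | j <- enum 'I_m] ++ nseq (n - m) 0) ->
    x != 0 -> x ^+ 2 != a * b -> x ^+ 2 != a -> x ^+ 2 != b ->
  (char_poly (transition C G)).[x] * (x ^+ 2 - a * b) ^+ #|G|
    = (x ^+ 2 - a * b) ^+ #|edges G| * (x ^+ 2 - a) ^+ (n - m)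
      * \prod_j ((x ^+ 2 - a) * (x ^+ 2 - b)
                 - 16 * x ^+ 2 / (R ^+ 2 * S ^+ 2) * lam j ^+ 2).
Proof.
move=> mE nE le_mn specA x0 xab xa xb.
have R0 : R != 0 by rewrite pnatr_eq0 -lt0n.
have S0 : S != 0 by rewrite pnatr_eq0 -lt0n.
have nz4 : (4 : C) != 0 by rewrite pnatr_eq0.
rewrite det_transition // -[RHS]mulrA; congr (_ * _).
set al := x ^+ 2 - b; set be := x ^+ 2 - a.
set p := 4 * x / R ^+ 2; set q := 4 * x / S ^+ 2.
have al0 : al != 0 by rewrite subr_eq0.
have be0 : be != 0 by rewrite subr_eq0.
have p0 : p != 0 by rewrite !mulf_neq0 ?invr_eq0 ?expf_neq0.
have q0 : q != 0 by rewrite !mulf_neq0 ?invr_eq0 ?expf_neq0.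
(* Either square root will do: the eigenvalues of A are symmetric, apart from
   the zeros, whose multiplicity is absorbed by the power of c. *)
pose c := sqrtC (al * be / (p * q)).
have c0 : c != 0.
  rewrite sqrtC_eq0; do 2?apply: mulf_neq0 => //.
  by rewrite invr_eq0; apply: mulf_neq0.
have c2 : c ^+ 2 = al * be / (p * q) by rewrite sqrtCK.
rewrite (@det_bipartite _ _ _ _ _ _ _ _ c) //; first last.
- by rewrite c2 divfK //; apply: mulf_neq0.
- move=> i j; rewrite /d mxE; case: (boolP (adj _ _)) => // /bipartite_adj ->.
  by case: (_ \in V).
rewrite !card_side mE nE spectrumP horner_prod (perm_big _ specA) /= big_cat /=.
rewrite big_flatten big_map big_enum /= big_nseq hornerXsubC subr0 iter_mulr_1.
rewrite (eq_bigr (fun j => c ^+ 2 - lam j ^+ 2)) => [|j _]; last first.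
  by rewrite !big_cons big_nil mulr1 !hornerXsubC opprK -subr_sqr.
rewrite [in RHS](eq_bigr (fun j => (p * q) * (c ^+ 2 - lam j ^+ 2))) => [|j _].
  rewrite big_split /= prodr_const card_ord.
  have -> : #|G| = (m + m + (n - m))%N.
    by rewrite -addnA subnKC // -mE -nE bipartite_setC cardsC.
  rewrite -{1}(subnKC le_mn) !exprD.
  (* The m pairs of diagonal entries cancel against c ^ (2 m). *)
  have -> : al ^+ m * (be ^+ m * be ^+ (n - m))
            = be ^+ (n - m) * (p * q) ^+ m * (c ^+ m * c ^+ m).
    rewrite -[c ^+ m * _]exprMn -expr2 c2 -mulrA -exprMn.
    rewrite [p * q * _]mulrC divfK; last exact: mulf_neq0.
    by rewrite exprMn mulrCA mulrC -!mulrA mulrCA.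
  by field; rewrite !expf_neq0.
rewrite [RHS]mulrC [RHS]mulrBl c2 divfK; last exact: mulf_neq0.
rewrite [be * al]mulrC [RHS]addrC [LHS]addrC [lam j ^+ 2 * _]mulrC.
by congr (- (_ * _) + _); rewrite /p /q; field; rewrite R0 S0.
Qed.
End Semiregular.
(** * The spectrum of the transition matrix *)

Lemma big_pm (C : numClosedFieldType) (M : pzSemiRingType) (z : C)
    (F : C -> M) :
  \prod_(w <- pm z) F w = F z * F (- z).
Proof. by rewrite !big_cons big_nil mulr1. Qed.

Lemma prod_pm (C : numClosedFieldType) (z : C) :
  \prod_(w <- pm z) ('X - w%:P) = 'X^2 - (z ^+ 2)%:P.
Proof.
by rewrite big_pm polyC_exp polyCN opprK -subr_sqr.
Qed.

Lemma prod_nseq_pm (C : numClosedFieldType) (z : C) k :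
  \prod_(w <- flatten (nseq k (pm z))) ('X - w%:P) = ('X^2 - (z ^+ 2)%:P) ^+ k.
Proof. by rewrite big_flatten big_nseq prod_pm iter_mulr_1. Qed.

Lemma connected_deg_gt0 (G : sgraph) (u v : G) :
  connected_graph G -> u != v -> (0 < deg u)%N.
Proof.
move=> Gconn; case/connectP: (Gconn u v) => -[|w p] /=.
  by move=> _ ->; rewrite eqxx.
by case/andP=> uw _ _ _; apply/card_gt0P; exists w; rewrite inE.
Qed.

(** If [V] had a vertex, so would the larger side [W], and connectedness would
    give positive degrees on both sides.  Hence [V] is empty, there are no
    edges, and a connected graph without edges has at most one vertex. *)
Lemma semiregular_degenerate (G : sgraph) (V W : {set G}) (r s : nat) :
    connected_graph G -> semiregular_bipartite V W r s -> (#|V| <= #|W|)%N ->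
    ~~ ((0 < r)%N && (0 < s)%N) ->
  [/\ #|V| = 0, (#|W| <= 1)%N, #|G| = #|W|, #|edges G| = 0 & #|arc G| = 0]%N.
Proof.
move=> Gconn Gsemi leVW rs0; have degE := deg_semiregular Gsemi.
have WE := bipartite_setC Gsemi.
have V0 : V = set0.
  apply/eqP; apply: contraNT rs0 => /set0Pn[v vV].
  have /card_gt0P[w wW] : (0 < #|W|)%N.
    by apply: leq_trans leVW; apply/card_gt0P; exists v.
  have wV : w \notin V by rewrite WE inE in wW.
  have vw : v != w by apply: contraNneq wV => <-.
  have := connected_deg_gt0 Gconn vw; rewrite eq_sym in vw.
  have := connected_deg_gt0 Gconn vw.
  by rewrite !degE vV (negbTE wV) => -> ->.
have noadj (u v : G) : ~~ adj u v.
  by apply/negP => /(bipartite_adj Gsemi); rewrite V0 !inE.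
have WT : W = [set: G] by rewrite WE V0 setC0.
have arc0 : #|arc G| = 0%N.
  by rewrite card_sig; apply: eq_card0 => a; rewrite !inE (negbTE (noadj _ _)).
split=> //; first by rewrite V0 cards0.
- rewrite leqNgt; apply/negP => /card_gt1P[u [v [_ _ uv]]].
  have /card_gt0P[w] := connected_deg_gt0 Gconn uv.
  by rewrite inE (negbTE (noadj _ _)).
- by rewrite WT cardsT.
- by have := card_arc G; rewrite arc0; case: #|edges G|.
Qed.

Lemma spectrum_dim0 (C : numClosedFieldType) k (M : 'M[C]_k) :
  k = 0%N -> spectrum M = [::].
Proof.
move=> k0; apply: size0nil; apply: succn_inj.
by rewrite -(size_prod_XsubC _ id) -spectrumP size_char_poly k0.
Qed.

Theorem corollary5 (C : numClosedFieldType) (G : sgraph) (V W : {set G})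
    (r s m n nu eps : nat) (lam : 'I_m -> C)
    (Gconn : connected_graph G)
    (Gsemi : semiregular_bipartite V W r s)
    (nuE : #|G| = nu) (epsE : #|edges G| = eps)
    (mE : #|V| = m) (nE : #|W| = n) (le_mn : (m <= n)%N)
    (specA : perm_eq (spectrum (adjacency C G))
               (flatten [seq pm (lam j) | j <- enum 'I_m] ++ nseq (n - m) 0)) :
  let R : C := r%:R in
  let S : C := s%:R in
  let N (j : 'I_m) : C :=
    2 * R ^+ 2 * S ^+ 2 - 4 * R * S ^+ 2 - 4 * R ^+ 2 * S + 16 * lam j ^+ 2 in
  let eig1 : seq C :=
    flatten [seq pm (sqrtC ((N j + d) / (2 * R ^+ 2 * S ^+ 2)))
            | j <- enum 'I_m,
              d <- pm (sqrtC (N j ^+ 2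
                         - 4 * R ^+ 3 * S ^+ 3 * (4 - R) * (4 - S)))] in
  let eig2 : seq C := pm ('i * sqrtC (4 / R - 1)) in
  let eig3 : seq C := pm (sqrtC ((4 / R - 1) * (4 / S - 1))) in
  (* If G is a tree then eps - nu = -1, and the count 2 (eps - nu) = -2 means
     that the two values of eig3 are to be removed from the other values. *)
  perm_eq (spectrum (transition C G) ++ flatten (nseq (nu - eps) eig3))
    (eig1 ++ flatten (nseq (n - m) eig2) ++ flatten (nseq (eps - nu) eig3)).
Proof.
cbv zeta; set R : C := r%:R; set S : C := s%:R; apply: prod_XsubC_eq.
pose N (j : 'I_m) : C :=
  2 * R ^+ 2 * S ^+ 2 - 4 * R * S ^+ 2 - 4 * R ^+ 2 * S + 16 * lam j ^+ 2.
pose D j : C := N j ^+ 2 - 4 * R ^+ 3 * S ^+ 3 * (4 - R) * (4 - S).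
set eig1 := flatten (allpairs_dep _ _ _).
rewrite !big_cat -spectrumP /= !prod_nseq_pm exprMn sqrCi !sqrtCK mulN1r.
case: (boolP ((0 < r)%N && (0 < s)%N)) => [/andP[r0 s0] | rs0]; last first.
  have leVW : (#|V| <= #|W|)%N by rewrite mE nE.
  have [V0 W1 GW E0 A0] := semiregular_degenerate Gconn Gsemi leVW rs0.
  have m0 : m = 0%N by rewrite -mE.
  have -> : eig1 = [::].
    by rewrite /eig1 (size0nil (etrans (size_enum_ord m) m0)).
  rewrite big_nil mul1r spectrumP spectrum_dim0 // big_nil mul1r.
  rewrite -epsE -nuE GW E0 nE m0 !subn0 sub0n expr0 mulr1.
  (* For a single vertex the statement says that eig3 and eig2 agree up to
     sign: as 4 / 0 = 0 and s = 0, their squares are both 1 - 4 / R. *)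
  rewrite nE in W1; case: (posnP n) => [->|n0]; first by rewrite !expr0.
  have s0 : s = 0%N.
    have /card_gt0P[w wW] : (0 < #|W|)%N by rewrite nE.
    case: Gsemi => _ _ /(_ w wW) <-; apply: eq_card0 => u.
    apply/negbTE; rewrite inE; apply/negP => wu.
    have : (0 < #|arc G|)%N by apply/card_gt0P; exists (exist _ (w, u) wu).
    by rewrite A0.
  by rewrite /S s0 invr0 mulr0 sub0r mulrN1.
have R0 : R != 0 by rewrite pnatr_eq0 -lt0n.
have S0 : S != 0 by rewrite pnatr_eq0 -lt0n.
pose a : C := 1 - 4 / R; pose b : C := 1 - 4 / S.
have -> : - (4 / R - 1) = a by rewrite opprB.
have -> : (4 / R - 1) * (4 / S - 1) = a * b by rewrite -mulrNN !opprB.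
have nz2 (z : C) : 'X^2 - z%:P != 0 by rewrite monic_neq0 ?monicXnsubC.
pose g := 'X * ('X^2 - (a * b)%:P) * ('X^2 - a%:P) * ('X^2 - b%:P).
apply: (@eq_poly_outside_roots _ g).
  by rewrite !mulf_neq0 ?polyX_eq0.
move=> x; rewrite !hornerE !mulf_eq0 !negb_or !subr_eq0 -!andbA.
case/and4P=> x0 xab xa xb.
(* The two values of d are opposite square roots of the discriminant, so the
   product is the monic quadratic in x ^ 2 with the two given roots. *)
have Pj (j : 'I_m) : (x ^+ 2 - a) * (x ^+ 2 - b)
      - 16 * x ^+ 2 / (R ^+ 2 * S ^+ 2) * lam j ^+ 2
    = \prod_(d <- pm (sqrtC (D j)))
        \prod_(z <- pm (sqrtC ((N j + d) / (2 * R ^+ 2 * S ^+ 2))))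
          ('X - z%:P).[x].
  under [RHS]eq_bigr do
    rewrite -horner_prod prod_pm sqrtCK hornerD hornerN hornerXn hornerC.
  rewrite big_pm.
  have -> t : (x ^+ 2 - (N j + t) / (2 * R ^+ 2 * S ^+ 2))
      * (x ^+ 2 - (N j - t) / (2 * R ^+ 2 * S ^+ 2))
    = x ^+ 4 - N j / (R ^+ 2 * S ^+ 2) * x ^+ 2
      + (N j ^+ 2 - t ^+ 2) / (4 * R ^+ 4 * S ^+ 4).
    by field; rewrite R0 S0.
  by rewrite sqrtCK /D /N /a /b; field; rewrite R0 S0.
have := det_transition_spectrum Gsemi r0 s0 mE nE le_mn specA x0 xab xa xb.
rewrite -/R -/S -/a -/b nuE epsE (eq_bigr _ (fun j _ => Pj j)) => detP.
rewrite /eig1 horner_prod big_flatten big_allpairs_dep big_enum /=.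
have y0 : x ^+ 2 - a * b != 0 by rewrite subr_eq0.
apply: (mulIf (expf_neq0 nu y0)); rewrite mulrAC detP.
(* Both differences of eps and nu are truncated; each of the two products of
   powers of y has exponent the maximum of eps and nu. *)
rewrite -[RHS]mulrA -exprD addnC -maxnE maxnC maxnE exprD.
ring.
Qed.
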